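(* Let $\pi=(d_1\le\cdots\le d_n)$ be a graphical sequence with $n\ge3$. Suppose that (a) for every integer $i$ with $1\le i<\tfrac12 n$: if $d_i\le i$ then $d_{n-i}\ge n-i$; and (b) if $n$ is even, then $d_n\ge\tfrac12n+1$. Then every realization of $\pi$ is pancyclic. Moreover, this condition is weakly optimal: if $\pi$ fails (a) for some $i$ then $\pi$ is majorized by the degree sequence of $K_i+(\overline{K_i}\cup K_{n-2i})$, which has no $n$-cycle, and if $\pi$ fails (b) then $\pi$ is majorized by the degree sequence of $K_{n/2,n/2}$, which is not pancyclic.
   Context: Graphs are finite and simple. A graphical sequence is a nondecreasing integer sequence that is the degree sequence of some graph (a realization). Majorization: $(d_i')\ge(d_i)$ iff $d_i'\ge d_i$ for all $i$. A graph on $n$ vertices is pancyclic if it contains a cycle of length $l$ for every $3\le l\le n$. $G\cup H$ is disjoint union, $G+H$ is the join, $\overline{K_i}$ is the edgeless graph on $i$ vertices. *)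

(* Defs.v *)
From mathcomp Require Import all_boot.
Set Implicit Arguments. Unset Strict Implicit. Unset Printing Implicit Defensive.

Definition simple_graph (n : nat) (e : rel 'I_n) : Prop :=
  symmetric e /\ irreflexive e.

Definition deg (n : nat) (e : rel 'I_n) (x : 'I_n) : nat := #|[pred y | e x y]|.

Definition degseq (n : nat) (e : rel 'I_n) : seq nat :=
  sort leq [seq deg e x | x <- enum 'I_n].

Definition graphical (n : nat) (pi : seq nat) : Prop :=
  exists e : rel 'I_n, simple_graph e /\ degseq e = pi.

(* 1-based indexing d_i of a sequence *)
Definition dd (pi : seq nat) (i : nat) : nat := nth 0 pi i.-1.

Definition has_cycle (n : nat) (e : rel 'I_n) (l : nat) : Prop :=
  exists f : 'I_l -> 'I_n, injective f /\ forall k : 'I_l, e (f k) (f (ordS k)).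

Definition pancyclic (n : nat) (e : rel 'I_n) : Prop :=
  forall l, 3 <= l <= n -> has_cycle e l.

Definition majorized_by (pi pi' : seq nat) : Prop :=
  size pi = size pi' /\ forall j, j < size pi -> nth 0 pi j <= nth 0 pi' j.

(* K_i + (\overline{K_i} \cup K_{n-2i}) on 'I_n: vertices < i form the K_i,
   vertices in [i, 2i) are independent, vertices >= 2i form K_{n-2i} *)
Definition Kjoin_graph (n i : nat) : rel 'I_n :=
  fun x y => (x != y) && [|| x < i, y < i | (i.*2 <= x) && (i.*2 <= y)].

Definition Kbip_graph (n : nat) : rel 'I_n :=
  fun x y => (x < n./2) != (y < n./2).

Arguments Kjoin_graph : clear implicits.
Arguments Kbip_graph : clear implicits.

(* Main.v *)
Require Import Defs.
From Stdlib Require Import Classical_Prop.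
From mathcomp Require Import all_boot.
From mathcomp Require Import zify.
Set Implicit Arguments. Unset Strict Implicit. Unset Printing Implicit Defensive.

(** Chvatal's condition gives a Hamiltonian cycle through the Bondy-Chvatal
    closure.  If two consecutive vertices [a], [b] of a Hamiltonian cycle have
    degree sum at least [n + 1], pairing the chords at [a] with those at [b]
    (Schmeichel and Hakimi) produces cycles of all lengths.  Call a vertex high
    when its degree is at least [n/2].

    For [n] odd there are more than [n/2] high vertices, so two of them are
    consecutive and the degree sum is large enough.

    For [n] even, let [w] have degree at least [n/2 + 1].  An [(n-1)]-cycle
    exists: the closure may be taken for nonadjacent pairs of degree sum at
    least [n + 1], after which [w] is joined to every high vertex and a
    rotation of the Hamiltonian cycle puts [w] next to a high vertex.  Suppose
    now that a length [l <= n - 2] is missing.  If two high vertices are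
    consecutive on the Hamiltonian cycle, both have degree exactly [n/2], and
    the chords at the two of them must alternate around the cycle, as in
    [K_{n/2,n/2}]; then [w] is again adjacent to one of them in a way that
    allows the same rotation.  Otherwise exactly half of the vertices are high,
    with degree at least [n/2 + 1], and an [(n-1)]-cycle either omits a high
    vertex, whose chords to that cycle give all lengths, or contains two
    consecutive high vertices. *)

(** * Counting along cyclic shifts *)

Lemma sum_shift (N s : nat) (Y : nat -> bool) :
  \sum_(c < N) Y ((c + s) %% N) = \sum_(c < N) Y c.
Proof.
case: N => [|N]; first by rewrite !big_ord0.
pose h (c : 'I_N.+1) := Ordinal (ltn_pmod (c + s) (ltn0Sn N)).
have h_inj : injective h.
  move=> c d /(congr1 val) /= /eqP; rewrite eqn_modDr !modn_small //.
  by move=> /eqP /val_inj.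
by rewrite [RHS](reindex_inj h_inj).
Qed.

Lemma shift_count_le (N s : nat) (X Y : nat -> bool) :
    (forall c, c < N -> X c -> ~~ Y ((c + s) %% N)) ->
  \sum_(c < N) X c + \sum_(c < N) Y c <= N.
Proof.
move=> XY; rewrite -(sum_shift N s Y) -big_split /=.
rewrite -[leqRHS]card_ord -sum1_card leq_sum // => c _.
by case Xc: (X c); [rewrite (negPf (XY _ (ltn_ord c) Xc))|case: (Y _)].
Qed.

(** Equality case of the disjointness bound: a position lying neither in [X] nor in [Y] moved back
    by [s] would leave a total of at most [N - 1]. *)
Lemma shift_count_eq (N s : nat) (X Y : nat -> bool) :
    (forall c, c < N -> X c -> ~~ Y ((c + s) %% N)) ->
    N <= \sum_(c < N) X c + \sum_(c < N) Y c ->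
  forall c, c < N -> Y ((c + s) %% N) = ~~ X c.
Proof.
move=> XY leN c ltcN; case Xc: (X c); first by rewrite (negPf (XY _ ltcN Xc)).
apply: contraTT leN => Yc; rewrite -ltnNge.
rewrite -(sum_shift N s Y) -big_split /= (bigD1 (Ordinal ltcN)) //= Xc (negPf Yc).
have lt0N: 0 < N by exact: leq_ltn_trans ltcN.
rewrite !add0n -[X in _ < X](prednK lt0N) ltnS -[X in _ <= X.-1]card_ord.
rewrite -(cardC1 (Ordinal ltcN)) -sum1_card leq_sum // => d _.
by case Xd: (X d); [rewrite (negPf (XY _ (ltn_ord d) Xd))|case: (Y _)].
Qed.

Lemma shift_count_exists (N s : nat) (X Y : nat -> bool) :
    N < \sum_(c < N) X c + \sum_(c < N) Y c ->
  exists2 c, c < N & X c && Y ((c + s) %% N).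
Proof.
move=> ltN; have [/existsP[c XYc]|] :=
  boolP [exists c : 'I_N, X c && Y ((c + s) %% N)]; first by exists c.
rewrite negb_exists => /forallP nXY; move: ltN; rewrite ltnNge.
case/negP; apply: (@shift_count_le N s) => c ltcN Xc.
by have := nXY (Ordinal ltcN); rewrite /= Xc.
Qed.

(** A rotation is injective, so a set it maps into itself is mapped onto itself; this is the
    equality case for [X] and its complement. *)
Lemma shift_invariant (N s : nat) (X : nat -> bool) :
    (forall c, c < N -> X c -> X ((c + s) %% N)) ->
  forall c, c < N -> X ((c + s) %% N) = X c.
Proof.
move=> Xs c ltcN; apply: negb_inj.
apply: (@shift_count_eq N s X (fun c => ~~ X c)) => // [d ltdN Xd|].
  by rewrite negbK Xs.
rewrite -big_split /= -[leqLHS]card_ord -sum1_card leq_sum // => d _.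
by case: (X d).
Qed.

(** * Alternation forced by a missing cycle length *)

Lemma even_gap a b : a <= b -> odd a = odd b -> b = a + (b - a)./2.*2.
Proof. lia. Qed.

(* [X c] and [Y c] stand for the adjacency of the two ends of a Hamiltonian path
   on [N + 2] vertices with its [c]-th inner vertex, and [s + 3] is the missing
   cycle length; the hypotheses exclude the cycles of that length with at most
   three chords, all at the ends. *)
Section Alternating.

Variables (N s q : nat) (X Y : nat -> bool).
Hypotheses (NE : N = s + q) (q_ge3 : 3 <= q).
Hypothesis XY : forall c, c < N -> Y ((c + s) %% N) = ~~ X c.
Hypotheses (X0 : X 0) (Xlast : ~~ X N.-1) (Y0 : ~~ Y 0) (Ylast : Y N.-1).
Hypothesis X2 : forall c, c + s.+1 < N -> X c -> ~~ X (c + s.+1).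
Hypothesis Y2 : forall c, c + s.+1 < N -> Y c -> ~~ Y (c + s.+1).
Hypothesis XYX : forall a m k,
  a <= m -> m < k -> k < N -> k + a = m + q -> X a -> Y m -> ~~ X k.
Hypothesis YXY : forall m j r,
  m < j -> j <= r -> r < N -> j + N.-1 = m + q + r -> Y m -> X j -> ~~ Y r.

Ltac arith := repeat match goal with
  | H : context [X _] |- _ => clear H
  | H : context [Y _] |- _ => clear H
  end; lia.

(** [Ylow] and [Yhigh] express [Y] through [X], according to whether the shift by [s] wraps around,
    so that constraints on [Y] become constraints on [X]. *)
Local Lemma Ylow c : c < s -> Y c = ~~ X (c + q).
Proof.
move=> ltcs; rewrite -XY; last by arith.
by congr Y; rewrite -addnA [q + s]addnC -NE modnDr modn_small //; arith.
Qed.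

Local Lemma Yhigh c : s <= c -> c < N -> Y c = ~~ X (c - s).
Proof.
move=> lesc ltcN; rewrite -XY; last by arith.
by congr Y; rewrite subnK // modn_small.
Qed.

Local Lemma Xq1 : ~~ X q.-1.
Proof. by have := Ylast; rewrite Yhigh; [congr (~~ X _) |..]; arith. Qed.

Local Lemma Xq : 0 < s -> X q.
Proof. by move=> s_gt0; move: Y0; rewrite Ylow // negbK. Qed.

(** Apply [XYX] at [m = k + a - q]: if [X] failed at [k + a], complementarity would give [Y m]. *)
Local Lemma XD a k : a < q -> q <= k -> k < N -> X a -> X k -> X ((k + a) %% N).
Proof.
move=> ltaq leqk ltkN Xa Xk; apply/negPn/negP => nX.
suff: ~~ X k by rewrite Xk.
apply: (XYX (a := a) (m := k + a - q)) => //; try arith.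
have [lt|le] := ltnP (k + a) N.
  rewrite Ylow; last by arith.
  by rewrite subnK; [move: nX; rewrite modn_small|arith].
rewrite Yhigh; try arith.
move: nX; rewrite -(subnK le) modnDr modn_small; last by arith.
by congr (~~ X _); arith.
Qed.

(** Apply [YXY] at [m = j - b - 1] and [r = s + b]: [~~ X b] gives [Y r], and failure of the
    conclusion would give [Y m]. *)
Local Lemma XE b j : b < j -> j <= s + b -> b < q -> ~~ X b -> X j -> X (j + q.-1 - b).
Proof.
move=> ltbj lejsb ltbq nXb Xj; apply/negPn/negP => nX.
suff: ~~ Y (s + b) by rewrite Yhigh ?addKn ?nXb //; arith.
apply: (YXY (m := j - b.+1) (j := j)) => //; try arith.
by rewrite Ylow; [move: nX; congr (~~ X _)|]; arith.
Qed.

(** [X] is invariant under rotation by [q], hence also by [s]; the exclusions [X2] and [Y2] at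
    distance [s + 1] then act on neighbouring positions. *)
Local Lemma alternating_small : s <= q -> ~~ odd N /\ forall c, c < N -> X c = ~~ odd c.
Proof.
move=> lesq.
have per c : c < N -> X ((c + q) %% N) = X c.
  apply: (@shift_invariant N q X) => {}c ltcN Xc.
  have [ltcs|lesc] := ltnP c s.
    by rewrite addnC XD //; [arith|arith|apply: Xq; arith].
  have -> : c + q = c - s + N by arith.
  rewrite modnDr modn_small; last by arith.
  have [s0|s_gt0] := posnP s; first by rewrite s0 subn0.
  apply/negPn/negP => nX.
  have := XE (b := c - s) (j := c); rewrite nX Xc => /(_ _ _ _ isT isT).
  have -> : c + q.-1 - (c - s) = N.-1 by arith.
  by rewrite (negPf Xlast) => H; have: false by apply: H; arith.
have perS c : c < q -> X (c + s) = X c.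
  move=> ltcq; rewrite -per; last by arith.
  by rewrite -addnA -NE modnDr modn_small //; arith.
have step c : c.+1 < q -> X c.+1 = ~~ X c.
  move=> ltcq; apply/idP/idP.
    by apply: contraTN => /X2 H; rewrite -perS // addSnnS H //; arith.
  apply: contraNT => nX1; have nYc: ~~ Y c.
    apply/negP => /Y2 H; have: ~~ Y (c + s.+1) by apply: H; arith.
    rewrite -addSnnS Yhigh; [|arith|arith].
    by rewrite addnK nX1.
  rewrite -per; last by arith.
  have [ltcs|lesc] := ltnP c s.
    by move: nYc; rewrite Ylow // negbK modn_small //; arith.
  have -> : c + q = c - s + N by arith.
  rewrite modnDr modn_small; last by arith.
  by move: nYc; rewrite Yhigh ?negbK //; arith.
have low c : c < q -> X c = ~~ odd c.
  by elim: c => // c IH ltcq; rewrite step // IH //; arith.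
have q_even : ~~ odd q.
  by move: Xq1; rewrite low; [rewrite negbK|]; arith.
have s_even : ~~ odd s.
  case: (ltngtP s q) lesq => // [ltsq _|-> _ //].
  by rewrite -low // -[s]add0n perS; [|arith].
split=> [|c ltcN]; first by rewrite NE oddD; arith.
have [ltcq|leqc] := ltnP c q; first exact: low.
have lesc : s <= c by arith.
by rewrite -[in LHS](subnK lesc) perS ?low; arith.
Qed.

(** With [a = 1], [XD] would carry [X] by unit steps from [q] to [N - 1], against [Xlast]. *)
Local Lemma X1 : 0 < s -> ~~ X 1.
Proof.
move=> s_gt0; apply/negP => X1.
suff H k : q + k < N -> X (q + k) by have := Xlast; rewrite (_ : N.-1 = q + s.-1) ?H; arith.
elim: k => [|k IH] ltkN; first by rewrite addn0 Xq.
have := @XD 1 (q + k); rewrite modn_small ?addn1 -?addnS //; last by arith.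
by apply; rewrite ?IH //; arith.
Qed.

(** Here the period is [q - 2], by [XD] with [a = q - 2] from [q] on and by [XE] with [b = 1] below.
    It yields [X 2], so [XD] moves by two from [q] on, and [Xlast] excludes the second parity
    class. *)
Local Lemma alternating_large : q < s -> ~~ odd N /\ forall c, c < N -> X c = ~~ odd c.
Proof.
move=> ltqs; have s_gt0 : 0 < s by arith.
have nX1 := X1 s_gt0; have Xqq := Xq s_gt0.
have Xq2 : X (q - 2).
  apply/negPn/negP => nX.
  (* With [b = q - 2], [XE] advances by one, so [X] would again reach [N - 1]. *)
  suff H k : q + k < N -> X (q + k) by have := Xlast; rewrite (_ : N.-1 = q + s.-1) ?H; arith.
  elim: k => [|k IH] ltkN; first by rewrite addn0.
  have := @XE (q - 2) (q + k); rewrite (_ : q + k + q.-1 - (q - 2) = q + k.+1); last by arith.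
  by apply=> //; rewrite ?IH //; arith.
have per c : c < N -> X ((c + (q - 2)) %% N) = X c.
  apply: shift_invariant => {}c ltcN Xc.
  case: (posnP c) => [->|c_gt0]; first by rewrite modn_small //; arith.
  have [c1|c_gt1] : c = 1 \/ 1 < c by arith.
    by move: Xc nX1; rewrite c1 => ->.
  have [leqc|ltcq] := leqP q c; first by apply: XD => //; arith.
  rewrite modn_small; last by arith.
  have := @XE 1 c; rewrite (_ : c + q.-1 - 1 = c + (q - 2)); last by arith.
  by apply=> //; arith.
have Xtwo : X 2 by rewrite -per; [rewrite subnKC ?modn_small //; arith|arith].
have q_gt3 : 3 < q.
  by case: (ltngtP 3 q) q_ge3 Xq1 Xtwo => // <- _ /= /negPf ->.
have X_up c : q <= c -> c + 2 < N -> X c -> X (c + 2).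
  by move=> leqc ltcN Xc; have := @XD 2 c; rewrite modn_small //; apply=> //; arith.
have X_ups c t : q <= c -> c + t.*2 < N -> X c -> X (c + t.*2).
  move=> leqc; elim: t => [|t IH] lt Xc; first by rewrite addn0.
  have -> : c + t.+1.*2 = c + t.*2 + 2 by rewrite doubleS; arith.
  by apply: X_up; [arith|arith|apply: IH => //; arith].
have X_par c d : q <= c -> c <= d -> d < N -> odd c = odd d -> X c -> X d.
  by move=> leqc lecd ltd /(even_gap lecd) dE; rewrite dE in ltd *; apply: X_ups.
have par_last : odd N.-1 != odd q.
  by apply/eqP => /esym/X_par H; move/negP: Xlast; apply; apply: H => //; arith.
have high c : q <= c -> c < N -> X c = (odd c == odd q).
  move=> leqc ltcN; apply/idP/eqP => [Xc|/esym/X_par]; last exact.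
  apply/eqP; apply: contraNT Xlast => par_c; apply: (X_par c) => //; [arith|arith|].
  by move: par_c par_last; case: (odd c); case: (odd q); case: (odd _).
have low c : 1 < c -> c < q -> X c = ~~ odd c.
  move=> c_gt1 ltcq; rewrite -per; last by arith.
  rewrite modn_small ?high; [|arith|arith|arith].
  by rewrite oddD oddB; [case: (odd c); case: (odd q)|arith].
have q_even : ~~ odd q.
  by move: Xq1; rewrite low ?negbK; [rewrite -[X in odd X -> _]subn1 oddB ?addbT|arith|]; arith.
split=> [|c ltcN].
  by move: par_last; rewrite (negPf q_even) eqbF_neg negbK -subn1 oddB ?addbT; arith.
have [leqc|ltcq] := leqP q c; first by rewrite high // (negPf q_even) eqbF_neg.
have [lec1|c_gt1] := leqP c 1; last exact: low.
by case: c lec1 {ltcN ltcq} => [|[|//]] _; rewrite ?X0 ?(negPf nX1).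
Qed.

Lemma alternating :
  ~~ odd N /\ forall c, c < N -> X c = ~~ odd c /\ Y c = odd c.
Proof.
have [N_even Xalt] : ~~ odd N /\ forall c, c < N -> X c = ~~ odd c.
  by have [/alternating_small|/alternating_large] := leqP s q.
have q_even : ~~ odd q by move: Xq1; rewrite Xalt; arith.
split=> // c ltcN; split; first exact: Xalt.
have [ltcs|lesc] := ltnP c s; first by rewrite Ylow // Xalt; arith.
by rewrite Yhigh // Xalt; arith.
Qed.

End Alternating.

(** * Paths, cycles and their assembly from arcs *)

Definition is_path (n : nat) (e : rel 'I_n) (k : nat) (p : nat -> 'I_n) : Prop :=
  (forall i j, i < k -> j < k -> p i = p j -> i = j) /\
  (forall i, i.+1 < k -> e (p i) (p i.+1)).

(** A cycle is a [k]-periodic map on [nat], so that rotating it or taking a window is a mere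
    translation of the argument. *)
Definition is_cycle (n : nat) (e : rel 'I_n) (k : nat) (q : nat -> 'I_n) : Prop :=
  (forall i j, q i = q j <-> i = j %[mod k]) /\ (forall i, e (q i) (q i.+1)).

Definition cyc n (e : rel 'I_n) k := exists q, is_cycle e k q.

Definition pcat (T : Type) (k : nat) (p1 p2 : nat -> T) (i : nat) : T :=
  if i < k then p1 i else p2 (i - k).

Section Paths.

Variables (n : nat) (e : rel 'I_n).
Hypothesis sym_e : symmetric e.

Lemma cyc_has_cycle l : cyc e l -> has_cycle e l.
Proof.
case=> q [q_inj q_e]; exists (fun i => q (nat_of_ord i)); split.
  by move=> i j /q_inj; rewrite !modn_small // => /val_inj.
move=> k /=; suff -> : q (k.+1 %% l) = q k.+1 by [].
by apply/q_inj; rewrite modn_mod.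
Qed.

Lemma closed_path_cycle k p :
  0 < k -> is_path e k p -> e (p k.-1) (p 0) -> is_cycle e k (fun i => p (i %% k)).
Proof.
move=> k_gt0 [p_inj p_e] p_close; split=> [i j|i].
  by split=> [/p_inj|->//]; apply; rewrite ltn_mod.
rewrite -[i.+1]addn1 -modnDml addn1; have := ltn_pmod i k_gt0.
move: (i %% k) => {}i ltik; have [lt|le] := ltnP i.+1 k.
  by rewrite [in X in e _ X]modn_small ?p_e.
have -> : i.+1 = k by lia.
by rewrite modnn (_ : i = k.-1) //; lia.
Qed.

Lemma closed_path_cyc k p :
  0 < k -> is_path e k p -> e (p k.-1) (p 0) -> cyc e k.
Proof. by move=> k_gt0 p_path p_close; eexists; apply: closed_path_cycle p_close. Qed.

Lemma subpath k p c m : is_path e k p -> c + m <= k -> is_path e m (fun j => p (c + j)).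
Proof.
case=> p_inj p_e le_k; split=> [i j lti ltj /p_inj H|i lti].
  by have := H _ _; lia.
by rewrite addnS p_e //; lia.
Qed.

Lemma cycle_window k q c m :
  is_cycle e k q -> m <= k -> is_path e m (fun j => q (c + j)).
Proof.
case=> q_inj q_e lemk; split=> [i j ltim ltjm /q_inj /eqP|i lti].
  by rewrite eqn_modDl !modn_small; [move/eqP| lia|lia].
by rewrite addnS q_e.
Qed.

Lemma path_cat k1 p1 k2 p2 :
    is_path e k1 p1 -> is_path e k2 p2 ->
    (forall i j, i < k1 -> j < k2 -> p1 i <> p2 j) ->
    e (p1 k1.-1) (p2 0) ->
  is_path e (k1 + k2) (pcat k1 p1 p2).
Proof.
move=> [inj1 e1] [inj2 e2] dis link; rewrite /pcat; split=> [i j lti ltj|i lti].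
  case: ltnP => [lti1|lei1]; case: ltnP => [ltj1|lej1].
  - exact: inj1.
  - by move/(dis i (j - k1) lti1); case; lia.
  - by move/esym/(dis j (i - k1) ltj1); case; lia.
  - by move/inj2 => H; have := H _ _; lia.
case: ltnP => [lti1|lei1]; case: ltnP => [ltj1|lej1].
- exact: e1.
- by have -> : i = k1.-1; [lia|rewrite prednK ?subnn //; lia].
- lia.
- by rewrite subSn // e2 //; lia.
Qed.

Variables (k : nat) (p : nat -> 'I_n).
Hypothesis p_path : is_path e k p.

Definition adist (u v : nat) := (u - v) + (v - u).

(** Walks along positions from [u] to [v] in either direction. By truncated subtraction [adist u v]
    is [|u - v|], so the arc has [(adist u v).+1] vertices. *)
Definition arc (u v i : nat) : nat := if u <= v then u + i else u - i.

Definition sep (u v u' v' : nat) : Prop := 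
  (u < u' /\ u < v') /\ (v < u' /\ v < v') \/ (u' < u /\ u' < v) /\ (v' < u /\ v' < v).

Lemma arc_path u v : u < k -> v < k -> is_path e (adist u v).+1 (fun i => p (arc u v i)).
Proof.
case: p_path => p_inj p_e ltuk ltvk; rewrite /arc /adist; case: leqP => leuv.
  split=> [i j lti ltj /p_inj H|i lti]; first by have := H _ _; lia.
  by rewrite addnS p_e //; lia.
split=> [i j lti ltj /p_inj H|i lti]; first by have := H _ _; lia.
by rewrite sym_e (_ : u - i = (u - i.+1).+1) ?p_e //; lia.
Qed.

Lemma arc_sep u v u' v' i j :
    u < k -> v < k -> u' < k -> v' < k -> sep u v u' v' ->
  i < (adist u v).+1 -> j < (adist u' v').+1 -> p (arc u v i) <> p (arc u' v' j).
Proof.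
case: p_path => p_inj _ ltu ltv ltu' ltv'; rewrite /sep /adist /arc => uv lti ltj /p_inj.
by do 2![case: ifP] => ? ? H; have := H _ _; lia.
Qed.

Lemma arc_end u v : arc u v (adist u v) = v.
Proof. by rewrite /arc /adist; case: ifP; lia. Qed.

Lemma arc_start u v : arc u v 0 = u.
Proof. by rewrite /arc addn0 subn0 if_same. Qed.

(* A path visiting the segments [u1..v1] and [u2..v2] of [p], each traversed
   monotonically in either direction. *)
Lemma path_arcs2 u1 v1 u2 v2 :
    u1 < k -> v1 < k -> u2 < k -> v2 < k -> sep u1 v1 u2 v2 ->
    e (p v1) (p u2) ->
  exists r, [/\ is_path e ((adist u1 v1).+1 + (adist u2 v2).+1) r, r 0 = p u1
              & r ((adist u1 v1).+1 + adist u2 v2) = p v2].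
Proof.
move=> ltu1 ltv1 ltu2 ltv2 dis link.
exists (pcat (adist u1 v1).+1 (fun i => p (arc u1 v1 i)) (fun i => p (arc u2 v2 i))).
split; first apply: path_cat; rewrite /pcat ?arc_start ?arc_end //; try exact: arc_path.
- by move=> i j; apply: arc_sep.
- by rewrite ltnNge leq_addr addKn /= arc_end.
Qed.

(** Cycles using chords are assembled from arcs of one path, possibly reversed; equal ends give a
    one-vertex arc. *)
Lemma cyc_arcs2 u1 v1 u2 v2 l :
    u1 < k -> v1 < k -> u2 < k -> v2 < k -> sep u1 v1 u2 v2 ->
    e (p v1) (p u2) -> e (p v2) (p u1) -> l = (adist u1 v1).+1 + (adist u2 v2).+1 ->
  cyc e l.
Proof.
move=> ltu1 ltv1 ltu2 ltv2 dis link close ->.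
have [r [r_path r0 rl]] := path_arcs2 ltu1 ltv1 ltu2 ltv2 dis link.
by apply: (closed_path_cyc _ r_path); rewrite // addnS /= r0 rl.
Qed.

Lemma cyc_arcs3 u1 v1 u2 v2 u3 v3 l :
    u1 < k -> v1 < k -> u2 < k -> v2 < k -> u3 < k -> v3 < k ->
    sep u1 v1 u2 v2 -> sep u1 v1 u3 v3 -> sep u2 v2 u3 v3 ->
    e (p v1) (p u2) -> e (p v2) (p u3) -> e (p v3) (p u1) ->
    l = (adist u1 v1).+1 + (adist u2 v2).+1 + (adist u3 v3).+1 ->
  cyc e l.
Proof.
move=> ltu1 ltv1 ltu2 ltv2 ltu3 ltv3 dis12 dis13 dis23 link12 link23 close ->.
pose p1 i := p (arc u1 v1 i); pose p2 i := p (arc u2 v2 i).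
pose p3 i := p (arc u3 v3 i).
have path12 : is_path e ((adist u1 v1).+1 + (adist u2 v2).+1) (pcat (adist u1 v1).+1 p1 p2).
  apply: path_cat; rewrite /p1 /p2 ?arc_start ?arc_end //; try exact: arc_path.
  by move=> i j; apply: arc_sep.
have path123 := path_cat path12 (arc_path ltu3 ltv3).
apply: closed_path_cyc (path123 _ _) _ => //.
- move=> i j lti ltj; rewrite /pcat; case: ltnP => lti1; first exact: arc_sep.
  by apply: arc_sep => //; lia.
- rewrite addnS /= /pcat ltnNge leq_addr addKn /= /p2 arc_end.
  by rewrite arc_start.
rewrite [_.-1](_ : _ = (adist u1 v1).+1 + (adist u2 v2).+1 + adist u3 v3); last by lia.
by rewrite {1}/pcat ltnNge leq_addr addKn /= arc_end /pcat /= /p1 arc_start.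
Qed.

End Paths.

Lemma path_inj_ord n (e : rel 'I_n) k p :
  is_path e k p -> injective (fun i : 'I_k => p i).
Proof. by case=> p_inj _ i j /p_inj H; apply/val_inj/H. Qed.

Lemma path_size n (e : rel 'I_n) k p : is_path e k p -> k <= n.
Proof. by move/path_inj_ord/leq_card; rewrite !card_ord. Qed.

Lemma card_le_path n (e : rel 'I_n) k p (A : pred 'I_n) :
  is_path e k p -> #|A| <= \sum_(c < k) A (p c) + (n - k).
Proof.
move=> p_path; have p_inj := path_inj_ord p_path.
pose S := [set p c | c : 'I_k].
have cardS : #|S| = k by rewrite card_imset ?card_ord.
rewrite -(cardID (mem S) A) leq_add //.
  rewrite -sum1_card (big_mkcond (fun c : 'I_n => c \in [predI A & S])) /=.
  rewrite (eq_bigr (fun x => if x \in S then nat_of_bool (A x) else 0)).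
    by rewrite -big_mkcond /= big_imset //= => c d _ _; apply: p_inj.
  by move=> x _; rewrite !inE unfold_in /=; case: (x \in S); rewrite ?andbT ?andbF; case: (A x).
rewrite -[X in _ <= X - k]card_ord -cardS -(cardC (mem S)) addKn.
by apply/subset_leq_card/subsetP => x; rewrite !inE => /andP[].
Qed.

(** Only [z] is off the path: adding it to the counted set absorbs the error term
    [n - (n - 1) = 1]. *)
Lemma card_le_omit n (e : rel 'I_n) p (A : pred 'I_n) z :
    0 < n -> is_path e n.-1 p -> (forall i, i < n.-1 -> p i != z) -> ~~ A z ->
  #|A| <= \sum_(c < n.-1) A (p c).
Proof.
move=> n_gt0 p_path p_z nAz; have := card_le_path (fun x => (x == z) || A x) p_path.
have -> : #|(fun x => (x == z) || A x)| = 1 + #|A|.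
  by have := cardU1 z A; rewrite [z \in A](negPf nAz) => <-; apply: eq_card.
rewrite (_ : n - n.-1 = 1); last by lia.
rewrite addnC leq_add2r; congr (_ <= _); apply: eq_bigr => c _.
by rewrite /= (negPf (p_z c _)).
Qed.

Lemma path_surj n (e : rel 'I_n) p (x : 'I_n) :
  is_path e n p -> exists2 i, i < n & p i = x.
Proof.
move=> p_path; have /injF_onto/(_ x) := path_inj_ord p_path.
by case/codomP => i ->; exists i.
Qed.

Lemma path_omit n (e : rel 'I_n) k p :
  is_path e k p -> k < n -> exists z, forall i, i < k -> p i != z.
Proof.
move=> p_path ltkn; pose S := [set p c | c : 'I_k].
have /set0Pn[z] : ~: S != set0.
  rewrite -card_gt0 cardsCs setCK card_ord subn_gt0.
  by rewrite card_imset ?card_ord //; exact: path_inj_ord p_path.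
rewrite inE => zS; exists z => i ltik; apply: contra zS => /eqP <-.
by apply/imsetP; exists (Ordinal ltik).
Qed.

(** * Cycle lengths from chords *)

Section Pancyclic.

Variables (n : nat) (e : rel 'I_n).
Hypotheses (sym_e : symmetric e) (irr_e : irreflexive e).

Section ClosedPath.

Variables (k : nat) (p : nat -> 'I_n).
Hypotheses (p_path : is_path e k p) (k_ge3 : 3 <= k) (p_close : e (p 0) (p k.-1)).

Let X c := e (p 0) (p c.+1).
Let Y c := e (p k.-1) (p c.+1).

(** Without wraparound the cycle consists of both ends and the [s + 1] inner vertices from [c] to
    [c + s]. With wraparound it consists of the two outer arcs, again with [s + 3] vertices. *)
Lemma cyc_shift s c :
  s + 3 < k -> c < k - 2 -> X c -> Y ((c + s) %% (k - 2)) -> cyc e (s + 3).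
Proof.
move=> lts ltc Xc; have [lt|le] := ltnP (c + s) (k - 2).
  rewrite modn_small // => Yd.
  by apply: (cyc_arcs3 sym_e p_path (u1 := 0) (v1 := 0) (u2 := c.+1) (v2 := (c + s).+1)
            (u3 := k.-1) (v3 := k.-1)); rewrite /sep /adist // 1?sym_e //; lia.
rewrite -(subnK le) modnDr modn_small => [Yd|]; last by lia.
by apply: (cyc_arcs2 sym_e p_path (u1 := 0) (v1 := (c + s - (k - 2)).+1) (u2 := k.-1)
          (v2 := c.+1)); rewrite /sep /adist // 1?sym_e //; lia.
Qed.

(** The summand [2] counts the closing edge once from each end. *)
Lemma end_degrees (S := fun x => \sum_(c < k) e x (p c)) :
  S (p 0) + S (p k.-1) = \sum_(c < k - 2) X c + \sum_(c < k - 2) Y c + 2.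
Proof.
have SE x : S x = e x (p 0) + \sum_(c < k - 2) e x (p c.+1) + e x (p k.-1).
  have [m kE] : exists m, k = m.+2 by exists (k - 2); lia.
  rewrite /S kE -addn2 addnK addn2 big_ord_recr big_ord_recl /=.
  by under eq_bigr do rewrite /bump add1n.
by rewrite !SE !irr_e p_close sym_e p_close /X /Y; lia.
Qed.

(** Apart from the closing edge, more than [k - 2] adjacencies fall on [k - 2] inner positions, so
    two of them match under the shift by [l - 3]. Length [k] is the closed path itself. *)
Lemma path_pancyclic l :
    k < \sum_(c < k) e (p 0) (p c) + \sum_(c < k) e (p k.-1) (p c) ->
  3 <= l <= k -> cyc e l.
Proof.
rewrite end_degrees => big_deg /andP[l_ge3 lelk].
have [->|neqlk] := eqVneq l k.
  by apply: (closed_path_cyc _ p_path); rewrite 1?sym_e //; lia.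
have lE : l = l - 3 + 3 by lia.
have [c ltc /andP[Xc Yc]] : exists2 c, c < k - 2 & X c && Y ((c + (l - 3)) %% (k - 2)).
  by apply: shift_count_exists; lia.
by rewrite lE; apply: cyc_shift Xc Yc; lia.
Qed.

Lemma path_missing s :
    k <= \sum_(c < k) e (p 0) (p c) + \sum_(c < k) e (p k.-1) (p c) ->
    s + 3 < k -> ~ cyc e (s + 3) ->
  forall c, c < k - 2 -> Y ((c + s) %% (k - 2)) = ~~ X c.
Proof.
rewrite end_degrees => big_deg lts no_cyc; apply: shift_count_eq; last by lia.
by move=> c ltc Xc; apply/negP => Yc; apply/no_cyc/(cyc_shift _ _ Xc).
Qed.

End ClosedPath.

Lemma deg_le_path x k p : is_path e k p -> deg e x <= \sum_(c < k) e x (p c) + (n - k).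
Proof. exact: card_le_path. Qed.

Lemma ham_path_pancyclic p l :
    is_path e n p -> e (p 0) (p n.-1) -> n < deg e (p 0) + deg e (p n.-1) ->
  3 <= l <= n -> cyc e l.
Proof.
move=> p_path p_close big_deg l_range.
apply: (path_pancyclic p_path) => //; first by lia.
apply: leq_trans big_deg _.
by rewrite leq_add // (leq_trans (deg_le_path _ p_path)) // subnn addn0.
Qed.

(** The path running up from [p i] to [p n.-1] and then down from [p i.-1] to [p 0] is Hamiltonian,
    and its ends are adjacent with degree sum above [n]. *)
Lemma ham_rotate_left p i l :
    is_path e n p -> e (p 0) (p n.-1) -> 0 < i < n ->
    e (p 0) (p i) -> e (p n.-1) (p i.-1) -> n < deg e (p 0) + deg e (p i) ->
  3 <= l <= n -> cyc e l.
Proof.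
move=> p_path p_close i_range e0i eni big_deg l_range.
have [|||||r []] := path_arcs2 sym_e p_path (u1 := i) (v1 := n.-1) (u2 := i.-1) (v2 := 0) _ _ _ _ _ eni; rewrite /sep /adist; try lia.
have -> : (i - n.-1 + (n.-1 - i)).+1 + (i.-1 - 0 + (0 - i.-1)).+1 = n by lia.
have -> : (i - n.-1 + (n.-1 - i)).+1 + (i.-1 - 0 + (0 - i.-1)) = n.-1 by lia.
move=> r_path r0 rn; apply: (ham_path_pancyclic r_path) => //; rewrite r0 rn.
  by rewrite sym_e.
by rewrite addnC.
Qed.

Lemma ham_rotate_right p i l :
    is_path e n p -> e (p 0) (p n.-1) -> i < n.-1 ->
    e (p n.-1) (p i) -> e (p 0) (p i.+1) -> n < deg e (p n.-1) + deg e (p i) ->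
  3 <= l <= n -> cyc e l.
Proof.
move=> p_path p_close i_range eni e0i big_deg l_range.
have [|||||r []] := path_arcs2 sym_e p_path (u1 := n.-1) (v1 := i.+1) (u2 := 0) (v2 := i) _ _ _ _ _ (etrans (sym_e _ _) e0i); rewrite /sep /adist; try lia.
have -> : (n.-1 - i.+1 + (i.+1 - n.-1)).+1 + (0 - i + (i - 0)).+1 = n by lia.
have -> : (n.-1 - i.+1 + (i.+1 - n.-1)).+1 + (0 - i + (i - 0)) = n.-1 by lia.
by move=> r_path r0 rn; apply: (ham_path_pancyclic r_path) => //; rewrite r0 rn.
Qed.

(* Two neighbours of the omitted vertex [z] at distance [l - 2] along the
   cycle give an [l]-cycle. *)
Lemma omitted_pancyclic q z l :
    is_cycle e n.-1 q -> (forall i, q i != z) -> n <= (deg e z).*2 ->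
  3 <= l <= n -> cyc e l.
Proof.
move=> q_cyc q_z big_deg l_range.
have q_path : is_path e n.-1 q by exact: (cycle_window 0 q_cyc).
pose Z c := e z (q c).
have degz : deg e z <= \sum_(c < n.-1) Z c.
  by apply: (card_le_omit _ q_path (z := z)); [lia|move=> i _; apply: q_z|rewrite /= irr_e].
have [c ltc /andP[Zc Zd]] : exists2 c, c < n.-1 & Z c && Z ((c + (l - 2)) %% n.-1).
  by apply: shift_count_exists; lia.
have {}Zd : Z (c + (l - 2)).
  by rewrite /Z (_ : q (c + (l - 2)) = q ((c + (l - 2)) %% n.-1)) //; apply/q_cyc.1; rewrite modn_mod.
have w_path : is_path e l.-1 (fun j => q (c + j)) by apply: cycle_window q_cyc _; lia.
have z_path : is_path e 1 (fun=> z) by split=> [[] [] //|[]].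
have zw_path : is_path e (1 + l.-1) (pcat 1 (fun=> z) (fun j => q (c + j))).
  apply: path_cat => //= [i j _ _ /esym/eqP|]; first exact/negP.
  by rewrite addn0.
have -> : l = 1 + l.-1 by lia.
apply: (closed_path_cyc _ zw_path) => //.
rewrite /pcat [_.-1](_ : _ = (l - 2).+1); last by lia.
by rewrite /= subn1 /= sym_e.
Qed.

End Pancyclic.

(** * The Bondy-Chvatal closure for cycles of length [s] *)

Section Closure.

Variable n : nat.

Definition add_edge (e : rel 'I_n) (a b : 'I_n) : rel 'I_n :=
  fun x y => [|| e x y, (x == a) && (y == b) | (x == b) && (y == a)].

Lemma add_edge_simple e a b :
  a != b -> simple_graph e -> simple_graph (add_edge e a b).
Proof.
rewrite /add_edge => neq_ab [sym_e irr_e]; split=> [x y|x].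
  by rewrite sym_e; congr (_ || _); rewrite orbC ![(y == _) && _]andbC.
rewrite irr_e /=; apply/negP => /orP[] /andP[/eqP -> /eqP eq_ab];
  by rewrite eq_ab eqxx in neq_ab.
Qed.

(** Each end has at most [n - s] neighbours off the path, so at least [s] adjacencies fall on
    [s - 1] positions and two chords cross. The threshold [2n - s] is [n] for [s = n] and [n + 1]
    for [s = n - 1]. *)
Lemma ore_crossing (e : rel 'I_n) s p :
    symmetric e -> irreflexive e -> 3 <= s -> is_path e s p ->
    ~~ e (p 0) (p s.-1) -> n.*2 <= deg e (p 0) + deg e (p s.-1) + s ->
  cyc e s.
Proof.
move=> sym_e irr_e s_ge3 p_path nadj big_deg.
have degl : deg e (p 0) <= \sum_(c < s.-1) e (p 0) (p c.+1) + (n - s).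
  have := deg_le_path (p 0) p_path; case: (s) s_ge3 => // s' _.
  by rewrite big_ord_recl irr_e.
have degr : deg e (p s.-1) <= \sum_(c < s.-1) e (p s.-1) (p c) + (n - s).
  have := deg_le_path (p s.-1) p_path; case: (s) s_ge3 => // s' _.
  by rewrite big_ord_recr /= irr_e addn0.
have les := path_size p_path.
have [c ltc /andP[Xc]] : exists2 c, c < s.-1 &
    e (p 0) (p c.+1) && e (p s.-1) (p ((c + 0) %% s.-1)).
  apply: (@shift_count_exists s.-1 0 (fun c => e (p 0) (p c.+1)) (fun c => e (p s.-1) (p c))).
  lia.
rewrite addn0 modn_small // => Yc.
by apply: (cyc_arcs2 sym_e p_path (u1 := 0) (v1 := c) (u2 := s.-1) (v2 := c.+1));
  rewrite /sep /adist // 1?sym_e //; lia.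
Qed.

(** If the cycle uses the new edge, cutting it there leaves a path of [e] between [a] and [b], to
    which crossing chords apply. *)
Lemma cyc_add_edge e a b s :
    simple_graph e -> 3 <= s -> ~~ e a b -> n.*2 <= deg e a + deg e b + s ->
  cyc (add_edge e a b) s -> cyc e s.
Proof.
move=> [sym_e irr_e] s_ge3 nadj big_deg [q q_cyc].
have [/forallP qe|] := boolP [forall i : 'I_s, e (q i) (q i.+1)].
  exists q; split=> [|i]; first exact: q_cyc.1.
  have lti : i %% s < s by rewrite ltn_mod; lia.
  rewrite (_ : q i = q (i %% s)); last by apply/q_cyc.1; rewrite modn_mod.
  rewrite (_ : q i.+1 = q (i %% s).+1); first exact: (qe (Ordinal lti)).
  by apply/q_cyc.1; rewrite -[(i %% s).+1]addn1 modnDml addn1.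
rewrite negb_forall => /existsP[[i lti] /= nei].
pose p j := q (i.+1 + j).
have ps : p s.-1 = q i.
  by apply/q_cyc.1; rewrite (_ : i.+1 + s.-1 = i + s) ?modnDr //; lia.
have p0 : p 0 = q i.+1 by rewrite /p addn0.
have ab : (p s.-1 = a /\ p 0 = b) \/ (p s.-1 = b /\ p 0 = a).
  have := q_cyc.2 i; rewrite /add_edge (negPf nei) ps p0 /=.
  by case/orP => /andP[/eqP -> /eqP ->]; [left|right].
have p'_path : is_path (add_edge e a b) s p by exact: cycle_window q_cyc _.
have p_path : is_path e s p.
  (* Injectivity keeps the new edge from occurring again inside the window. *)
  case: p'_path => p_inj p_e; split=> // j ltj.
  have := p_e j ltj; rewrite /add_edge => /or3P[//|/andP[/eqP pa /eqP pb]|/andP[/eqP pa /eqP pb]].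
    case: ab => [[Ea Eb]|[Ea Eb]].
      by have := p_inj j s.-1; rewrite pa Ea => H; have := H _ _ erefl; lia.
    by have := p_inj j.+1 s.-1; have := p_inj j 0; rewrite pa pb Ea Eb => H H'; have := H _ _ erefl; have := H' _ _ erefl; lia.
  case: ab => [[Ea Eb]|[Ea Eb]].
    by have := p_inj j.+1 s.-1; have := p_inj j 0; rewrite pa pb Ea Eb => H H'; have := H _ _ erefl; have := H' _ _ erefl; lia.
  by have := p_inj j s.-1; rewrite pa Ea => H; have := H _ _ erefl; lia.
apply: (ore_crossing sym_e irr_e s_ge3 p_path); first by rewrite ps p0 sym_e.
by case: ab => [[-> ->]|[-> ->]] //; rewrite [deg e b + _]addnC.
Qed.

(** Induction on the number of nonadjacent ordered pairs. As [P] passes to supergraphs and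
    [cyc_add_edge] brings cycles back, the graph may be assumed closed. *)
Lemma closure_ind s (P : rel 'I_n -> Prop) :
    3 <= s ->
    (forall e e', subrel e e' -> P e -> P e') ->
    (forall e, simple_graph e -> P e ->
       (forall a b, a != b -> n.*2 <= deg e a + deg e b + s -> e a b) -> cyc e s) ->
  forall e, simple_graph e -> P e -> cyc e s.
Proof.
move=> s_ge3 P_mono P_max e.
have [m] := ubnP (#|[pred ab : 'I_n * 'I_n | ~~ e ab.1 ab.2]|).
elim: m => // m IH in e *; rewrite ltnS => le_m e_simple Pe.
have [/forallP e_max|] := boolP [forall a, forall b,
    (a != b) && (n.*2 <= deg e a + deg e b + s) ==> e a b].
  apply: P_max => // a b neq_ab big_deg.
  by have /forallP/(_ b)/implyP := e_max a; apply; rewrite neq_ab.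
rewrite negb_forall => /existsP[a]; rewrite negb_forall => /existsP[b].
rewrite negb_imply => /andP[/andP[neq_ab big_deg] nadj].
have sub : subrel e (add_edge e a b) by move=> x y; rewrite /add_edge => ->.
apply: (cyc_add_edge e_simple s_ge3 nadj big_deg).
apply: IH; last exact: P_mono sub Pe; last exact: add_edge_simple.
apply: leq_trans le_m; apply/proper_card/properP; split.
  by apply/subsetP => xy; rewrite !inE; apply: contra => /sub.
by exists (a, b); rewrite !inE /add_edge ?eqxx ?orbT.
Qed.

End Closure.

(** * Chvatal's condition, Hamiltonicity and high vertices *)

Lemma deg_subrel n (e e' : rel 'I_n) x : subrel e e' -> deg e x <= deg e' x.
Proof. by move=> sub; apply/subset_leq_card/subsetP => y; apply: sub. Qed.

(** Condition (a) by counting: [d_i <= i] says that at least [i] vertices have degree at most [i],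
    and [d_(n-i) >= n - i] that more than [i] have degree at least [n - i]. *)
Definition chvatal n (e : rel 'I_n) : Prop :=
  forall i, 0 < i -> i.*2 < n -> i <= #|[pred x | deg e x <= i]| ->
  i < #|[pred x | n - i <= deg e x]|.

Lemma chvatal_mono n (e e' : rel 'I_n) : subrel e e' -> chvatal e -> chvatal e'.
Proof.
move=> sub chv i i_gt0 lti lo; apply: leq_trans (chv i i_gt0 lti _) _.
  apply: leq_trans lo _; apply/subset_leq_card/subsetP => x; rewrite !inE.
  exact/leq_trans/deg_subrel.
apply/subset_leq_card/subsetP => x; rewrite !inE => le.
exact/(leq_trans le)/deg_subrel.
Qed.

Lemma card_ltn_ex (T : finType) (A B : pred T) : #|A| < #|B| -> exists2 x, B x & ~~ A x.
Proof.
move=> ltAB; have /subsetPn[x] : ~~ (B \subset A).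
  by apply: contraL ltAB => /subset_leq_card; rewrite leqNgt.
by rewrite !unfold_in; exists x.
Qed.

Lemma card_nonadjacent n (e : rel 'I_n) v :
  irreflexive e -> #|[pred x | (x != v) && ~~ e v x]| + (deg e v).+1 = n.
Proof.
move=> irr_e; rewrite -[RHS]card_ord -(cardC [pred x | (x != v) && ~~ e v x]).
congr (_ + _); have := cardU1 v [pred y | e v y]; rewrite inE irr_e add1n => <-.
by apply: eq_card => x; rewrite !inE negb_and !negbK.
Qed.

(** In a closed graph that is not complete, take a nonadjacent pair with maximal degree sum and
    [deg u <= deg v]. At least [deg u] vertices, the non-neighbours of [v], have degree at most
    [deg u]. The condition then gives a vertex of degree at least [n - deg u] not adjacent to [u],
    against closedness. *)
Lemma chvatal_hamiltonian n (e : rel 'I_n) :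
  3 <= n -> simple_graph e -> chvatal e -> cyc e n.
Proof.
move=> n_ge3; apply: closure_ind => //; first exact: chvatal_mono.
move=> {}e [sym_e irr_e] chv e_max.
have {}e_max a b : a != b -> n <= deg e a + deg e b -> e a b.
  by move=> neq_ab big_deg; apply: e_max => //; lia.
have [/existsP[[a b] nab]|] :=
    boolP [exists ab : 'I_n * 'I_n, (ab.1 != ab.2) && ~~ e ab.1 ab.2]; last first.
  rewrite negb_exists => /forallP complete.
  have adj a b : a != b -> e a b.
    by move=> neq_ab; have := complete (a, b); rewrite /= neq_ab negbK.
  case: n n_ge3 e sym_e irr_e chv e_max complete adj => [|n'] n_ge3 e sym_e irr_e chv e_max complete adj; first by [].
  have inord_inj i j : i < n'.+1 -> j < n'.+1 -> inord i = inord j :> 'I_n'.+1 -> i = j.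
    by move=> lti ltj /(congr1 val); rewrite /= !inordK.
  apply: (closed_path_cyc (p := inord)) => //; first split=> [|i lti]; first exact: inord_inj.
    by apply: adj; apply/eqP => /inord_inj H; have := H _ _; lia.
  by apply: adj; apply/eqP => /inord_inj H; have := H _ _; lia.
have [[u v] /= /andP[neq_uv nadj] uv_max {a b nab}] :
    exists2 ab : 'I_n * 'I_n, (ab.1 != ab.2) && ~~ e ab.1 ab.2 &
      forall x y, x != y -> ~~ e x y -> deg e x + deg e y <= deg e ab.1 + deg e ab.2.
  pose nadjp (ab : 'I_n * 'I_n) := (ab.1 != ab.2) && ~~ e ab.1 ab.2.
  case: (@arg_maxnP _ (a, b) nadjp (fun ab => deg e ab.1 + deg e ab.2) nab) => ab nab' ab_max.
  by exists ab => // x y neq_xy nxy; apply: (ab_max (x, y)); rewrite /nadjp neq_xy.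
wlog le_uv : u v neq_uv nadj uv_max / deg e u <= deg e v.
  move=> H; case: (leqP (deg e u) (deg e v)) => [|/ltnW]; first exact: H.
  by apply: H; rewrite 1?eq_sym 1?sym_e // => x y *; rewrite [leqRHS]addnC uv_max.
have lt_uv : deg e u + deg e v < n.
  by rewrite ltnNge; apply: contra nadj => /e_max; apply.
exfalso; have card_v := card_nonadjacent v irr_e.
have lo : n - (deg e v).+1 <= #|[pred x | deg e x <= deg e u]|.
  rewrite -[X in X - _]card_v addnK; apply/subset_leq_card/subsetP => x.
  rewrite !inE => /andP[neq_xv nvx]; have := uv_max x v neq_xv.
  by rewrite sym_e leq_add2r; apply.
(* [maxn 1] covers an isolated [u], as the condition starts at [i = 1]. *)
have lo1 : 0 < #|[pred x | deg e x <= maxn 1 (deg e u)]|.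
  by apply/card_gt0P; exists u; rewrite inE leq_maxr.
have hi : maxn 1 (deg e u) < #|[pred x | n - maxn 1 (deg e u) <= deg e x]|.
  apply: chv; [lia|lia|].
  case: (posnP (deg e u)) lo1 => [->|u_gt0 _]; first by [].
  by rewrite (maxn_idPr u_gt0); lia.
have [x deg_x nux] : exists2 x, n - maxn 1 (deg e u) <= deg e x & ~~ e u x.
  by apply: card_ltn_ex; apply: leq_ltn_trans hi; rewrite leq_maxr.
have neq_ux : u != x by apply/eqP => eq_ux; move: deg_x; rewrite -eq_ux; lia.
have : deg e x + 2 <= n.
  have : 0 < #|[pred y | (y != x) && ~~ e x y]|.
    by apply/card_gt0P; exists u; rewrite !inE neq_ux sym_e.
  by have := card_nonadjacent x irr_e; lia.
have : deg e u + deg e x < n.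
  by rewrite ltnNge; apply: contra nux; apply: e_max.
lia.
Qed.

Definition high n (e : rel 'I_n) : pred 'I_n := fun x => n <= (deg e x).*2.

(** Let [m] be the largest integer below [n/2]; high means degree above [m]. Fewer than [m] low
    vertices leave more than half high. Otherwise the condition at [m] gives more than [m] vertices
    of degree at least [n - m]; if exactly half the vertices are high, these are all of them. *)
Lemma high_half n (e : rel 'I_n) :
    3 <= n -> chvatal e ->
  n < #|high e|.*2 \/
  [/\ ~~ odd n, #|high e|.*2 = n & forall x, high e x -> n./2 < deg e x].
Proof.
move=> n_ge3 chv; have [m mE] : exists m, m = n.-1./2 by exists n.-1./2.
have highE x : high e x = (m < deg e x) by rewrite /high; lia.
have cardH : #|[pred x | deg e x <= m]| + #|high e| = n.
  rewrite -[RHS]card_ord -(cardC [pred x | deg e x <= m]); congr (_ + _).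
  by apply: eq_card => x; rewrite !inE [LHS]highE ltnNge.
have [lo|hi'] := ltnP #|[pred x | deg e x <= m]| m; first by left; lia.
have hi : m < #|[pred x | n - m <= deg e x]| by apply: chv => //; lia.
have sub : [pred x | n - m <= deg e x] \subset high e.
  apply/subsetP => x; rewrite inE => le_x; rewrite -[_ \in _]/(high e x) highE.
  by apply: leq_trans le_x; lia.
have le : m < #|high e| := leq_trans hi (subset_leq_card sub).
have [|le'] := ltnP n #|high e|.*2; [by left|right].
split; [lia|lia|].
have eq_card_hi : #|[pred x | n - m <= deg e x]| = #|high e|.
  apply/eqP; rewrite eqn_leq (subset_leq_card sub) /=.
  by apply: leq_trans hi; lia.
have /subset_cardP/(_ sub) eqH := eq_card_hi.
move=> x hx; have := eqH x; rewrite inE [RHS]hx; apply: leq_trans.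
by lia.
Qed.

Lemma cycle_consecutive n (e : rel 'I_n) k q (A : pred 'I_n) :
    is_cycle e k q -> k < (\sum_(c < k) A (q c)).*2 ->
  exists c, A (q c) && A (q c.+1).
Proof.
move=> [q_inj _]; rewrite -addnn => /(@shift_count_exists k 1 (fun c => A (q c)) (fun c => A (q c))).
case=> c _ Acc; exists c; rewrite (_ : q c.+1 = q ((c + 1) %% k)) //.
by apply/q_inj; rewrite modn_mod addn1.
Qed.

Lemma cycle_cut n (e : rel 'I_n) k q c :
    symmetric e -> 0 < k -> is_cycle e k q ->
  exists p, [/\ is_path e k p, e (p 0) (p k.-1), p 0 = q c.+1 & p k.-1 = q c].
Proof.
move=> sym_e k_gt0 q_cyc; exists (fun j => q (c.+1 + j)).
have qk : q (c.+1 + k.-1) = q c.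
  by apply/q_cyc.1; rewrite addSnnS prednK // modnDr.
rewrite qk addn0 sym_e; split=> //; first exact: cycle_window q_cyc _.
exact: q_cyc.2.
Qed.

(** * Hamiltonian cycles with two consecutive high vertices *)

Section HighPair.

Variables (n : nat) (e : rel 'I_n) (p : nat -> 'I_n) (w : 'I_n).
Hypotheses (sym_e : symmetric e) (irr_e : irreflexive e) (n_ge3 : 3 <= n).
Hypotheses (p_path : is_path e n p) (p_close : e (p 0) (p n.-1)).
Hypotheses (high0 : high e (p 0)) (high_last : high e (p n.-1)).
Hypothesis high_w : n.+1 < (deg e w).*2.

Let X c := e (p 0) (p c.+1).
Let Y c := e (p n.-1) (p c.+1).

Lemma high_pair_inner l : 3 <= l <= n ->
  cyc e l \/ [/\ (deg e (p 0)).*2 = n, (deg e (p n.-1)).*2 = n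
              & exists2 c, c < n - 2 & p c.+1 = w].
Proof.
move=> l_range.
have [big_deg|le_deg] := ltnP n (deg e (p 0) + deg e (p n.-1)).
  by left; apply: (ham_path_pancyclic sym_e irr_e p_path).
have deg0 : (deg e (p 0)).*2 = n by move: high0 high_last; rewrite /high; lia.
have degl : (deg e (p n.-1)).*2 = n by move: high0 high_last; rewrite /high; lia.
right; split=> //; have [i lti pi] := path_surj w p_path.
have i_gt0 : i <> 0 by move=> i0; move: high_w; rewrite -pi i0; lia.
have i_lt : i <> n.-1 by move=> i0; move: high_w; rewrite -pi i0; lia.
by exists i.-1; [lia|rewrite prednK //; lia].
Qed.

Lemma high_pair_missing s : s + 3 < n -> ~ cyc e (s + 3) ->
  forall c, c < n - 2 -> Y ((c + s) %% (n - 2)) = ~~ X c.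
Proof.
move=> lts no_cyc; apply: (path_missing sym_e irr_e p_path) => //.
have := deg_le_path (p 0) p_path; have := deg_le_path (p n.-1) p_path.
by move: high0 high_last; rewrite /high; lia.
Qed.

(** If length [n - 1] is missing, complementarity with the shift [n - 4], which is [-2] modulo
    [n - 2], supplies one of the two chords beside [w] that allow a rotation making [w] an end next
    to a high end. *)
Lemma high_pair_near : 3 < n -> (p 0 != w -> e (p 0) w) -> (p n.-1 != w -> e (p n.-1) w) ->
  cyc e n.-1.
Proof.
move=> n_gt3 adj0 adjl; have l_range : 3 <= n.-1 <= n by lia.
have [//|[deg0 degl [c ltc pc]]] := high_pair_inner l_range.
have e0w : e (p 0) w.
  by apply: adj0; apply/eqP; rewrite -pc => /p_path.1 H; have := H _ _; lia.
have elw : e (p n.-1) w.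
  by apply: adjl; apply/eqP; rewrite -pc => /p_path.1 H; have := H _ _; lia.
have [//|no_cyc] := classic (cyc e n.-1).
have miss := @high_pair_missing (n - 4).
have {}miss : forall c, c < n - 2 -> Y ((c + (n - 4)) %% (n - 2)) = ~~ X c.
  by apply: miss; [lia|rewrite (_ : n - 4 + 3 = n.-1) //; lia].
have rotl : e (p n.-1) (p c) -> cyc e n.-1.
  move=> elc; apply: (ham_rotate_left sym_e irr_e p_path p_close (i := c.+1)) => //; rewrite ?pc //.
    by lia.
  by lia.
have rotr : e (p 0) (p c.+2) -> cyc e n.-1.
  move=> elc; apply: (ham_rotate_right sym_e irr_e p_path p_close (i := c.+1)) => //; rewrite ?pc //.
    by lia.
  by lia.
(* When [w] is next to an end of the path, the chord needed is the closing edge. *)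
case: (posnP c) rotl => [-> rotl|c_gt0 rotl]; first by apply: rotl; rewrite sym_e.
have [ltc'|lec'] := ltnP c.+1 (n - 2); last first.
  by apply: rotr; rewrite (_ : c.+2 = n.-1) //; lia.
have := miss c.+1 ltc'; rewrite (_ : c.+1 + (n - 4) = c.-1 + (n - 2)); last by lia.
rewrite modnDr modn_small /Y /X ?prednK //; last by lia.
by case: (boolP (e (p 0) (p c.+2))) => [/rotr//|_ /rotl].
Qed.

(** A missing length forces alternation, and the parity of the position of [w] then decides which
    rotation is available. *)
Lemma high_pair_far l : 3 <= l <= n - 2 -> cyc e l.
Proof.
move=> l_range; have l_range' : 3 <= l <= n by lia.
have [//|[deg0 degl [c ltc pc]]] := high_pair_inner l_range'.
have [//|no_cyc] := classic (cyc e l).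
have [s lE] : exists s, l = s + 3 by exists (l - 3); lia.
have miss : forall c, c < n - 2 -> Y ((c + s) %% (n - 2)) = ~~ X c.
  by apply: high_pair_missing; rewrite -?lE //; lia.
(* Otherwise the first [n - 1] vertices form a cycle omitting the high vertex [p n.-1], whose chords
   give every length; [Y0] is the mirror image. *)
have Xlast : ~~ X (n - 2).-1.
  apply/negP => Xl; apply: no_cyc.
  have r_path : is_path e n.-1 (fun j => p (0 + j)) by apply: subpath p_path _; lia.
  apply: (omitted_pancyclic sym_e irr_e (closed_path_cycle _ r_path _) (z := p n.-1)) => //=.
  - by lia.
  - by rewrite sym_e add0n [0 + _](_ : _ = (n - 2).-1.+1) //; lia.
  move=> i; apply/eqP => /p_path.1 H.
  have lti : i %% n.-1 < n.-1 by rewrite ltn_mod; lia.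
  by have := H _ _; lia.
have Y0 : ~~ Y 0.
  apply/negP => Yl; apply: no_cyc.
  have r_path : is_path e n.-1 (fun j => p (1 + j)) by apply: subpath p_path _; lia.
  apply: (omitted_pancyclic sym_e irr_e (closed_path_cycle _ r_path _) (z := p 0)) => //=.
  - by lia.
  - by rewrite [1 + _](_ : _ = n.-1) //; lia.
  by move=> i; apply/eqP => /p_path.1 H; have := H _ _; lia.
have [N_even alt] : ~~ odd (n - 2) /\ forall c, c < n - 2 -> X c = ~~ odd c /\ Y c = odd c.
  apply: (@alternating (n - 2) s (n - 2 - s)) => //; try lia.
  - by case: p_path => _; apply; lia.
  - rewrite /Y (_ : (n - 2).-1.+1 = n.-2); last by lia.
    rewrite sym_e.
    by case: p_path => _ /(_ n.-2); rewrite prednK; [apply|]; lia.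
  - move=> c' ltc' Xc; apply/negP => Xd; apply: no_cyc.
    by apply: (cyc_arcs2 sym_e p_path (u1 := 0) (v1 := 0) (u2 := c'.+1)
          (v2 := (c' + s.+1).+1)); rewrite /sep /adist // 1?sym_e //; lia.
  - move=> c' ltc' Yc; apply/negP => Yd; apply: no_cyc.
    by apply: (cyc_arcs2 sym_e p_path (u1 := n.-1) (v1 := n.-1) (u2 := c'.+1)
          (v2 := (c' + s.+1).+1)); rewrite /sep /adist // 1?sym_e //; lia.
  - move=> a m k leam ltmk ltk E Xa Ym; apply/negP => Xk; apply: no_cyc.
    by apply: (cyc_arcs3 sym_e p_path (u1 := 0) (v1 := 0) (u2 := a.+1) (v2 := m.+1)
          (u3 := n.-1) (v3 := k.+1)); rewrite /sep /adist // 1?sym_e //; lia.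
  - move=> m j r ltmj lejr ltr E Ym Xj; apply/negP => Yr; apply: no_cyc.
    by apply: (cyc_arcs3 sym_e p_path (u1 := n.-1) (v1 := n.-1) (u2 := r.+1) (v2 := j.+1)
          (u3 := 0) (v3 := m.+1)); rewrite /sep /adist // 1?sym_e //; lia.
have [Xc Yc] := alt c ltc.
case: (boolP (odd c)) => odd_c; rewrite odd_c in Xc Yc.
  apply: (ham_rotate_right sym_e irr_e p_path p_close (i := c.+1)) => //; rewrite ?pc //.
  - by lia.
  - have [ltc'|lec'] := ltnP c.+1 (n - 2); last by rewrite (_ : c.+2 = n.-1) //; lia.
    by have [] := alt c.+1 ltc'; rewrite /X /= odd_c.
  - by lia.
apply: (ham_rotate_left sym_e irr_e p_path p_close (i := c.+1)) => //; rewrite ?pc //.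
- by lia.
- have [->|c_gt0] := posnP c; first by rewrite sym_e.
  have [|_] := alt c.-1; first by lia.
  by rewrite /Y prednK //=; lia.
- by lia.
Qed.

End HighPair.

(** * Cycles of length [n - 1], then of all lengths *)

Lemma card_le_ham_cycle n (e : rel 'I_n) q (A : pred 'I_n) :
  is_cycle e n q -> #|A| <= \sum_(c < n) A (q c).
Proof.
move=> q_cyc; have := card_le_path A (cycle_window 0 q_cyc (leqnn n)).
by rewrite subnn addn0.
Qed.

Lemma cycle_alternate n (e : rel 'I_n) k q (A : pred 'I_n) :
    0 < k -> is_cycle e k q -> k <= (\sum_(c < k) A (q c)).*2 ->
    (forall c, ~~ (A (q c) && A (q c.+1))) ->
  forall c, A (q c.+1) = ~~ A (q c).
Proof.
move=> k_gt0 [q_inj _]; rewrite -addnn => big nAA c.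
have qS d : q ((d + 1) %% k) = q d.+1 by apply/q_inj; rewrite modn_mod addn1.
have qm d : q (d %% k) = q d by apply/q_inj; rewrite modn_mod.
have := @shift_count_eq k 1 (fun c => A (q c)) (fun c => A (q c)) _ big (c %% k).
rewrite modnDml qS qm; apply; last by rewrite ltn_mod.
by move=> d _ Ad; have := nAA d; rewrite Ad qS.
Qed.

Lemma near_hamiltonian n (e : rel 'I_n) :
    3 < n -> simple_graph e ->
    chvatal e /\ (exists w, n.+1 < (deg e w).*2) ->
  cyc e n.-1.
Proof.
move=> n_gt3; apply: (@closure_ind n n.-1 (fun e => chvatal e /\ exists w, n.+1 < (deg e w).*2)).
- by lia.
- move=> {}e e' sub [chv [w big_w]]; split; first exact: chvatal_mono chv.
  by exists w; apply: leq_trans big_w _; rewrite leq_double deg_subrel.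
move=> {}e e_simple [chv [w big_w]] e_max.
have {}e_max a b : a != b -> n < deg e a + deg e b -> e a b.
  by move=> neq_ab big_deg; apply: e_max => //; lia.
have n_ge3 : 3 <= n by lia.
have [q q_cyc] := chvatal_hamiltonian n_ge3 e_simple chv.
case: e_simple => sym_e irr_e.
have [[c /andP[hc hc']]|no_pair] := classic (exists c, high e (q c) && high e (q c.+1)).
  have [|p [p_path p_close p0 pl]] := cycle_cut c sym_e _ q_cyc; first by lia.
  have h0 : high e (p 0) by rewrite p0.
  have hl : high e (p n.-1) by rewrite pl.
  apply: (high_pair_near sym_e irr_e n_ge3 p_path p_close h0 hl big_w n_gt3).
    by move=> neq; apply: e_max => //; move: h0 big_w; rewrite /high; lia.
  by move=> neq; apply: e_max => //; move: hl big_w; rewrite /high; lia.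
have on_q := card_le_ham_cycle (high e) q_cyc.
have [big_H|[n_even half_H high_deg]] := high_half n_ge3 chv.
  have [|c pair_c] := cycle_consecutive (A := high e) q_cyc; first by lia.
  by case: no_pair; exists c.
have alt : forall c, high e (q c.+1) = ~~ high e (q c).
  apply: (cycle_alternate _ q_cyc) => [||c]; first by lia.
    by rewrite -{1}half_H leq_double.
  by apply/negP => pair_c; apply: no_pair; exists c.
have [x hx] : exists x, high e x by apply/card_gt0P; rewrite -double_gt0 half_H; lia.
have [c _ qc] := path_surj x (cycle_window 0 q_cyc (leqnn n)).
rewrite /= add0n in qc; rewrite -qc in hx.
have hx2 : high e (q c.+2) by rewrite !alt negbK.
have neq : q c != q c.+2.
  apply/eqP => /q_cyc.1 /eqP; rewrite -[X in X == _ %[mod _]]addn0 -addn2 eqn_modDl.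
  by rewrite !modn_small; lia.
(* Alternating high vertices have degree above [n/2], so closedness joins those two steps apart, and
   the cycle can skip [q c.+1]. *)
have adj : e (q c) (q c.+2).
  by apply: e_max => //; have := high_deg _ hx; have := high_deg _ hx2; lia.
have p_path : is_path e n.-1 (fun j => q (c.+2 + j)) by apply: cycle_window q_cyc _; lia.
apply: (closed_path_cyc _ p_path); first by lia.
rewrite addn0 (_ : q (c.+2 + n.-1.-1) = q c) //.
by apply/q_cyc.1; rewrite (_ : c.+2 + n.-1.-1 = c + n) ?modnDr //; lia.
Qed.

Lemma chvatal_pancyclic n (e : rel 'I_n) l :
    3 <= n -> simple_graph e -> chvatal e ->
    (~~ odd n -> exists w, n.+1 < (deg e w).*2) ->
  3 <= l <= n -> cyc e l.
Proof.
move=> n_ge3 e_simple chv big_w l_range.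
have ham := chvatal_hamiltonian n_ge3 e_simple chv.
have [q q_cyc] := ham; case: (e_simple) => sym_e irr_e.
have on_q := card_le_ham_cycle (high e) q_cyc.
have big_H : n < #|high e|.*2 -> exists p, [/\ is_path e n p, e (p 0) (p n.-1),
    high e (p 0) & high e (p n.-1)].
  move=> big; have [|c /andP[hc hc']] := cycle_consecutive (A := high e) q_cyc.
    by lia.
  have [|p [p_path p_close p0 pl]] := cycle_cut c sym_e _ q_cyc; first by lia.
  by exists p; rewrite p0 pl in p_close *.
have [n_odd|n_even] := boolP (odd n).
  have [/big_H[p [p_path p_close h0 hl]]|[]] := high_half n_ge3 chv; last by rewrite n_odd.
  apply: (ham_path_pancyclic sym_e irr_e p_path) => //.
  (* For odd [n] a high degree is at least [(n + 1)/2], so two of them sum to more than [n]. *)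
  by move: h0 hl; rewrite /high; lia.
have {big_w}[w big_w] := big_w n_even.
have n_gt3 : 3 < n by lia.
have near : cyc e n.-1 by apply: near_hamiltonian => //; split=> //; exists w.
have [->//|[->//|l_range']] : l = n \/ l = n.-1 \/ 3 <= l <= n - 2 by lia.
have [/big_H[p [p_path p_close h0 hl]]|[_ half_H high_deg]] := high_half n_ge3 chv.
  exact: (high_pair_far sym_e irr_e n_ge3 p_path p_close h0 hl big_w).
have [r r_cyc] := near.
have r_path : is_path e n.-1 r by exact: (cycle_window 0 r_cyc (leqnn _)).
have [|z r_z] := path_omit r_path; first by lia.
have [hz|nhz] := boolP (high e z).
  apply: (omitted_pancyclic sym_e irr_e r_cyc (z := z)) => // i.
  rewrite (_ : r i = r (i %% n.-1)); last by apply/r_cyc.1; rewrite modn_mod.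
  by apply: r_z; rewrite ltn_mod; lia.
have on_r : #|high e| <= \sum_(c < n.-1) high e (r c).
  by apply: card_le_omit r_path r_z nhz; lia.
(* All [n/2] high vertices lie on a cycle of length [n - 1], so two are consecutive. *)
have [|c /andP[hc hc']] := cycle_consecutive (A := high e) r_cyc; first by lia.
have [|p [p_path p_close p0 pl]] := cycle_cut c sym_e _ r_cyc; first by lia.
(* Each end loses at most one neighbour to the omitted vertex, which leaves a degree sum of at least
   [2 (n/2 + 1) - 2 = n] on [n - 1] vertices. *)
apply: (path_pancyclic sym_e irr_e p_path) => //; try lia.
have := deg_le_path (p 0) p_path; have := deg_le_path (p n.-1.-1) p_path.
rewrite p0 pl; have := high_deg _ hc; have := high_deg _ hc'; lia.
Qed.

(** * Degree sequences as counts *)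

Lemma nth_sorted_le s j v :
  sorted leq s -> j < size s -> (nth 0 s j <= v) = (j < count (fun d => d <= v) s).
Proof.
elim: s j => // x s IH j /=; rewrite (path_sortedE leq_trans) => /andP[le_x s_sorted].
have [le_xv|lt_vx] := leqP x v; first by case: j => [|j] ltj //=; rewrite IH.
have -> : count (fun d => d <= v) s = 0.
  apply/eqP; rewrite -leqn0 leqNgt -has_count -all_predC.
  by apply: sub_all le_x => y /=; rewrite -ltnNge; apply: leq_trans.
case: j => [|j] ltj /=; first by rewrite leqNgt lt_vx.
apply/negbTE; rewrite -ltnNge; apply: leq_trans lt_vx _.
by move/allP: le_x; apply; apply: mem_nth.
Qed.

Section DegreeSequence.

Variables (n : nat) (e : rel 'I_n).

Lemma size_degseq : size (degseq e) = n.
Proof. by rewrite size_sort size_map -cardE card_ord. Qed.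

Lemma nth_degseq_le j v :
  j < n -> (nth 0 (degseq e) j <= v) = (j < #|[pred x | deg e x <= v]|).
Proof.
move=> ltj; rewrite nth_sorted_le ?size_degseq ?sort_sorted //; last exact: leq_total.
congr (_ < _); rewrite (permP (permEl (perm_sort _ _))) count_map.
by rewrite -sum1_count big_enum_cond -sum1_card; apply: eq_bigl => x; rewrite !inE.
Qed.

Lemma nth_degseq_ge j v :
  j < n -> #|[pred x | deg e x < v]| <= j -> v <= nth 0 (degseq e) j.
Proof.
case: v => // v ltj le_j; rewrite ltnNge nth_degseq_le // -leqNgt.
by apply: leq_trans le_j; apply: subset_leq_card; apply/subsetP.
Qed.

Lemma nth_degseq_mem j : j < n -> exists x, nth 0 (degseq e) j = deg e x.
Proof.
move=> ltj; have : nth 0 (degseq e) j \in degseq e by rewrite mem_nth ?size_degseq.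
by rewrite mem_sort => /mapP[x _ ->]; exists x.
Qed.

Lemma degseq_chvatal :
  (forall i, 1 <= i -> i.*2 < n -> dd (degseq e) i <= i -> n - i <= dd (degseq e) (n - i)) ->
  chvatal e.
Proof.
move=> cond i i_gt0 lti lo; have := cond i i_gt0 lti; rewrite /dd nth_degseq_le; last by lia.
rewrite prednK // lo => /(_ isT) hi.
(* At most [n - i - 1] vertices have degree below [n - i], so more than [i] remain. *)
have le_lo : #|[pred x | deg e x <= (n - i).-1]| <= (n - i).-1.
  by rewrite leqNgt -nth_degseq_le -?ltnNge; lia.
have := cardC [pred x | deg e x <= (n - i).-1]; rewrite card_ord.
have -> : #|[predC [pred x | deg e x <= (n - i).-1]]| = #|[pred x | n - i <= deg e x]|.
  by apply: eq_card => x; rewrite !inE -ltnNge prednK //; lia.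
move: le_lo; set lo' := #|_|; set hi' := #|_|; lia.
Qed.

End DegreeSequence.

(** * Weak optimality *)

Lemma card_ord_range n a b : a <= b -> b <= n -> #|[pred x : 'I_n | a <= x < b]| = b - a.
Proof.
move=> leab lebn; rewrite -sum1_card.
rewrite -(big_mkord (fun i => a <= i < b) (fun=> 1)) sum1_count /index_iota subn0.
have -> : n = a + ((b - a) + (n - b)) by lia.
rewrite !iotaD !count_cat add0n subnKC //.
rewrite (@eq_in_count _ _ pred0) ?count_pred0 => [|x]; last by rewrite mem_iota /=; lia.
rewrite (@eq_in_count _ _ predT (iota a _)) ?count_predT ?size_iota => [|x]; last by rewrite mem_iota /=; lia.
rewrite (@eq_in_count _ _ pred0 (iota b _)) ?count_pred0 => [|x]; last by rewrite mem_iota /=; lia.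
by rewrite addn0.
Qed.

Lemma deg_lower n (e : rel 'I_n) x (A : pred 'I_n) :
  (forall y, ~~ e x y -> A y) -> n - #|A| <= deg e x.
Proof.
move=> sub; rewrite leq_subLR -[leqLHS]card_ord -(cardC [pred y | e x y]) addnC leq_add2r.
by apply/subset_leq_card/subsetP => y; rewrite !inE => /sub.
Qed.

(** The extremal graph has [i] degrees [i], then [n - 2i] degrees [n - i - 1], then [i] degrees
    [n - 1]. Failure of (a) caps the first [i] entries at [i] and the first [n - i] at [n - i - 1];
    a simple graph has no degree above [n - 1]. *)
Lemma Kjoin_majorizes n (e : rel 'I_n) i :
    irreflexive e -> 1 <= i -> i.*2 < n -> dd (degseq e) i <= i ->
    dd (degseq e) (n - i) < n - i ->
  majorized_by (degseq e) (degseq (Kjoin_graph n i)).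
Proof.
move=> irr_e i_gt0 lti lo hi; split=> [|j]; rewrite !size_degseq // => ltj.
have degK_low (x : 'I_n) : x < i -> n.-1 <= deg (Kjoin_graph n i) x.
  move=> ltx; rewrite -subn1 -[X in _ - X](card1 x); apply: deg_lower => y.
  by rewrite /Kjoin_graph ltx andbT negbK => /eqP ->; rewrite inE.
have degK_high (x : 'I_n) : i.*2 <= x -> n - i.+1 <= deg (Kjoin_graph n i) x.
  move=> lex; have <- : #|[predU1 x & [pred y : 'I_n | i <= y < i.*2]]| = i.+1.
    rewrite cardU1 !inE card_ord_range; lia.
  by apply: deg_lower => y; rewrite /Kjoin_graph /=; case: (eqVneq y x) => //= _; rewrite inE; lia.
have degK_all (x : 'I_n) : i <= deg (Kjoin_graph n i) x.
  have [ltx|lex] := ltnP x i; first by apply: leq_trans (degK_low x ltx); lia.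
  have {1}<- : #|[pred y : 'I_n | 0 <= y < i]| = i by rewrite card_ord_range; lia.
  apply/subset_leq_card/subsetP => y; rewrite !inE /Kjoin_graph => /= lty.
  by rewrite lty orbT andbT; apply/eqP => xy; move: lex lty; rewrite xy; lia.
have [ltji|leij] := ltnP j i.
  apply: leq_trans (_ : i <= _).
    move: lo; rewrite /dd !nth_degseq_le //; last by lia.
    by apply: leq_trans; lia.
  apply: nth_degseq_ge => //; rewrite (_ : #|_| = 0) //; apply: eq_card0 => x.
  by rewrite inE ltnNge degK_all.
have [ltj'|lej] := ltnP j (n - i).
  apply: leq_trans (_ : n - i.+1 <= _).
    move: hi; rewrite /dd -[X in _ < X -> _](prednK (_ : 0 < n - i)); last by lia.
    rewrite ltnS !nth_degseq_le //; last by lia.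
    rewrite subnS; apply: leq_trans; lia.
  apply: nth_degseq_ge => //; apply: leq_trans leij.
  apply: leq_trans (_ : #|[pred y : 'I_n | i <= y < i.*2]| <= _); last first.
    by rewrite card_ord_range; lia.
  apply/subset_leq_card/subsetP => x; rewrite !inE => lt_deg.
  apply/andP; split; rewrite leqNgt.
    apply: contraL lt_deg => /degK_low; rewrite -leqNgt; lia.
  by rewrite ltnS; apply: contraL lt_deg => /degK_high; rewrite -leqNgt.
apply: leq_trans (_ : n.-1 <= _).
  have [x ->] := nth_degseq_mem e ltj.
  by have := card_nonadjacent x irr_e; lia.
apply: nth_degseq_ge => //; apply: leq_trans lej.
apply: leq_trans (_ : #|[pred y : 'I_n | i <= y < n]| <= _); last first.
  by rewrite card_ord_range; lia.
apply/subset_leq_card/subsetP => x; rewrite !inE ltn_ord andbT => lt_deg; rewrite leqNgt.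
by apply: contraL lt_deg => /degK_low; rewrite -leqNgt.
Qed.

(* On a Hamiltonian cycle both neighbours of each of the [i] independent
   vertices lie in [K_i]; by counting, these [2i] vertices are closed under
   successor, hence would be all the vertices. *)
Lemma Kjoin_not_hamiltonian n i :
  1 <= i -> i.*2 < n -> ~ has_cycle (Kjoin_graph n i) n.
Proof.
move=> i_gt0 lti [f [f_inj f_e]].
pose A := [set k | i <= f k < i.*2]; pose B := [set k | f k < i].
have card_pre a b : a <= b -> b <= n -> #|[set k | a <= f k < b]| = b - a.
  move=> leab lebn; rewrite -(card_ord_range leab lebn) -[RHS]cardsE.
  by rewrite -[RHS](card_preimset _ f_inj); apply: eq_card => k; rewrite !inE.
have cardA : #|A| = i by rewrite card_pre; lia.
have cardB : #|B| = i by rewrite -[RHS]subn0 -card_pre //; lia.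
have eA k : k \in A -> f (ordS k) < i.
  by have := f_e k; rewrite !inE /Kjoin_graph; lia.
have eA' k : k \in A -> f (ord_pred k) < i.
  by have := f_e (ord_pred k); rewrite ord_predK !inE /Kjoin_graph; lia.
have succ_A : @ordS n @: A = B.
  apply/eqP; rewrite eqEcard cardB card_imset ?cardA ?leqnn ?andbT; last exact: ordS_inj.
  by apply/subsetP => _ /imsetP[k kA ->]; rewrite inE eA.
have pred_A : @ord_pred n @: A = B.
  apply/eqP; rewrite eqEcard cardB card_imset ?cardA ?leqnn ?andbT; last exact: ord_pred_inj.
  by apply/subsetP => _ /imsetP[k kA ->]; rewrite inE eA'.
have closed k : k \in A :|: B -> ordS k \in A :|: B.
  rewrite !in_setU => /orP[kA|]; first by rewrite -succ_A imset_f ?orbT.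
  by rewrite -pred_A => /imsetP[a aA ->]; rewrite ord_predK aA.
have [k0 k0B] : exists k, k \in B by apply/card_gt0P; rewrite cardB.
have iterE t : val (iter t (@ordS n) k0) = (k0 + t) %% n.
  elim: t => [|t IH]; first by rewrite addn0 modn_small.
  by rewrite iterS /= IH -[(_ %% n).+1]addn1 modnDml addn1 addnS.
have iterU t : iter t (@ordS n) k0 \in A :|: B.
  by elim: t => [|t IH]; [rewrite inE k0B orbT|apply: closed].
(* The vertex [2i] exists since [2i < n] and lies outside both classes, yet [n - k0 + k] successor
   steps from [k0] reach its position [k]. *)
have /injF_onto/(_ (Ordinal lti))/codomP[k fk] := f_inj.
have := iterU (n - k0 + k).
rewrite (_ : iter _ _ _ = k); last first.
  apply/val_inj; rewrite iterE addnA subnKC ?modnDl ?modn_small //; exact: ltnW.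
by rewrite !inE -fk /=; lia.
Qed.

(** Failure of (b) caps every entry at [n/2], and every degree of the bipartite graph is at least
    that. *)
Lemma Kbip_majorizes n (e : rel 'I_n) :
    ~~ odd n -> 0 < n -> dd (degseq e) n < n./2 + 1 ->
  majorized_by (degseq e) (degseq (Kbip_graph n)).
Proof.
move=> n_even n_gt0 hi; split=> [|j]; rewrite !size_degseq // => ltj.
apply: leq_trans (_ : n./2 <= _).
  move: hi; rewrite /dd addn1 ltnS !nth_degseq_le //; last by lia.
  by apply: leq_trans; lia.
apply: nth_degseq_ge => //; rewrite (_ : #|_| = 0) //; apply: eq_card0 => x.
rewrite inE ltnNge; apply/negbTE; rewrite negbK.
have [ltx|lex] := ltnP x n./2.
  have {1}-> : n./2 = n - #|[pred y : 'I_n | 0 <= y < n./2]| by rewrite card_ord_range; lia.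
  by apply: deg_lower => y; rewrite /Kbip_graph ltx /=; case: ltnP.
have {1}-> : n./2 = n - #|[pred y : 'I_n | n./2 <= y < n]| by rewrite card_ord_range; lia.
by apply: deg_lower => y; rewrite /Kbip_graph ltnNge lex /= ltn_ord andbT; case: ltnP.
Qed.

Lemma Kbip_triangle_free n : ~ has_cycle (Kbip_graph n) 3.
Proof.
case=> f [_ f_e]; pose side (k : 'I_3) := f k < n./2.
have alt k : side (ordS k) = ~~ side k.
  by have := f_e k; rewrite /Kbip_graph -/(side k) -/(side (ordS k)); do 2!case: (side _).
have : ordS (ordS (ordS (@ord0 2))) = ord0 by apply/val_inj.
by move/(congr1 side); rewrite !alt; case: (side _).
Qed.

Theorem theorem3p5p5 (n : nat) (pi : seq nat) :
  3 <= n -> graphical n pi ->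
  (* main statement *)
  ( ((forall i, 1 <= i -> i.*2 < n -> dd pi i <= i -> n - i <= dd pi (n - i)) /\
     (~~ odd n -> n./2 + 1 <= dd pi n)) ->
    forall e : rel 'I_n, simple_graph e -> degseq e = pi -> pancyclic e )
  /\
  (* weak optimality: failure of (a) *)
  ( forall i, 1 <= i -> i.*2 < n -> dd pi i <= i -> dd pi (n - i) < n - i ->
    majorized_by pi (degseq (Kjoin_graph n i)) /\ ~ has_cycle (Kjoin_graph n i) n )
  /\
  (* weak optimality: failure of (b) *)
  ( ~~ odd n -> dd pi n < n./2 + 1 ->
    majorized_by pi (degseq (Kbip_graph n)) /\ ~ pancyclic (Kbip_graph n) ).
Proof.
move=> n_ge3 [e0 [[sym_e0 irr_e0] <-]]; split; [|split].
- move=> [cond_a cond_b] e e_simple eq_deg l l_range; rewrite -eq_deg in cond_a cond_b.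
  apply/cyc_has_cycle/chvatal_pancyclic => //; first exact: degseq_chvatal.
  (* A vertex attaining the last entry of the degree sequence, at index [n - 1], serves as [w]. *)
  move=> n_even; have [|x dx] := @nth_degseq_mem n e n.-1; first by lia.
  by exists x; move: (cond_b n_even); rewrite /dd dx; lia.
- move=> i i_gt0 lti lo hi; split; last exact: Kjoin_not_hamiltonian.
  exact: Kjoin_majorizes.
move=> n_even hi; split; first by apply: Kbip_majorizes => //; lia.
by move/(_ 3); rewrite n_ge3 => /(_ isT); apply: Kbip_triangle_free.
Qed.
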